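(* Consider the \textsc{Normal Domination Game} and let $n\geq 0$. The nimbers of the paths $P_1$, $P_2$ and $P_3$ are $1$, $1$ and $2$, respectively. Moreover, if $n\geq 4$, then the nimber of $P_n$ is $0$, $1$, $1$ or $3$ according as $n \bmod 4$ is $0$, $1$, $2$ or $3$, respectively. Consequently, Bob (the second player) wins the \textsc{Normal Domination Game} on the path $P_n$ if and only if $n$ is a multiple of $4$.
   Context: $P_n$ is the path with vertices $v_1,\dots,v_n$ and edges $v_1v_2,\dots,v_{n-1}v_n$. A vertex dominates itself and its neighbors. In the \textsc{Normal Domination Game} on a graph $G$, Alice (first) and Bob alternately select playable vertices, where a vertex is playable if it dominates at least one vertex not dominated by previously selected vertices; the game ends when no vertex is playable, and the last player to move wins. This is an impartial game. The nimber (Sprague–Grundy value) of a position is defined recursively as the minimum excludant $\mathrm{mex}$ (least non-negative integer not in the set) of the set of nimbers of the positions reachable in one move; a position with no moves has nimber $0$. The first player wins from a position iff its nimber is nonzero. *)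

(* Defs.v *)
From mathcomp Require Import all_boot.

Set Implicit Arguments.
Unset Strict Implicit.
Unset Printing Implicit Defensive.

Record sgraph := SGraph {
  vertex :> finType;
  edge : rel vertex;
  edge_sym : symmetric edge;
  edge_irr : irreflexive edge }.

Lemma mex_exists (s : seq nat) : exists k, k \notin s.
Proof.
exists (sumn s).+1; apply/negP => ms.
have /= e := perm_sumn (perm_to_rem ms).
by have := leq_addr (sumn (rem (sumn s).+1 s)) (sumn s).+1; rewrite -e ltnn.
Qed.

Definition mex (s : seq nat) : nat := ex_minn (mex_exists s).

Section DominationGame.
Variable G : sgraph.

Definition dominates (u v : G) : bool := (u == v) || edge u v.

(* A position is the set S of the vertices selected so far. *)
Definition dominated (S : {set G}) (w : G) : bool :=
  [exists u in S, dominates u w].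

Definition playable (S : {set G}) (v : G) : bool :=
  [exists w, dominates v w && ~~ dominated S w].

(* A playable vertex is not in S, so #|~: S| bounds the number of remaining
   moves and is enough fuel; nimberE below is the defining recursion. *)
Fixpoint nimber_rec (k : nat) (S : {set G}) : nat :=
  if k is k'.+1 then
    mex [seq nimber_rec k' (v |: S) | v <- enum G & playable S v]
  else 0.

Definition nimber (S : {set G}) : nat := nimber_rec #|~: S| S.

Lemma playable_notin S v : playable S v -> v \notin S.
Proof.
move=> /existsP[w /andP[vw /existsPn nw]]; apply/negP => vS.
by have := nw v; rewrite vS vw.
Qed.

Lemma mex_nil : mex [::] = 0.
Proof. by rewrite /mex; case: ex_minnP => [[//|k]] _ /(_ 0 isT). Qed.

Lemma nimberE S :
  nimber S = mex [seq nimber (v |: S) | v <- enum G & playable S v].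
Proof.
have cardC v : playable S v -> #|~: S| = #|~: (v |: S)|.+1.
  move=> /playable_notin vS.
  have vC : v \in ~: S by rewrite inE.
  by rewrite (cardsD1 v) vC add1n setCU setIC -setDE.
rewrite {1}/nimber; case E: #|~: S| => [|k] /=.
  rewrite (_ : [seq v <- enum G | _] = [::]) ?mex_nil //.
  apply/eqP; rewrite -(negbK (_ == _)) -has_filter; apply/hasPn => v _.
  by apply/negP => /cardC; rewrite E.
congr mex; apply/eq_in_map => v; rewrite mem_filter => /andP[/cardC + _].
by rewrite E /nimber => -[<-].
Qed.

Inductive player := Alice | Bob.

Definition opponent (p : player) : player :=
  if p is Alice then Bob else Alice.

(* winning p q S: p has a winning strategy from the position S when it is the
   turn of q.  In the first rule, no move is available to the opponent of p,
   so that p wins; this makes Bob the winner on the graph without vertices. *)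
Inductive winning (p : player) : player -> {set G} -> Prop :=
| winning_end S :
    (forall v, ~~ playable S v) -> winning p (opponent p) S
| winning_move S v :
    playable S v -> winning p (opponent p) (v |: S) -> winning p p S
| winning_reply S :
    (exists v, playable S v) ->
    (forall v, playable S v -> winning p p (v |: S)) ->
    winning p (opponent p) S.

Definition graph_nimber : nat := nimber set0.

Definition wins_game (p : player) : Prop := winning p Alice set0.

End DominationGame.

(* The vertex v_i of the path is the ordinal i - 1. *)
Definition path_rel (n : nat) : rel 'I_n :=
  fun i j => (i.+1 == j :> nat) || (j.+1 == i :> nat).

Lemma path_rel_sym n : symmetric (@path_rel n).
Proof. by move=> i j; rewrite /path_rel orbC. Qed.

Lemma path_rel_irr n : irreflexive (@path_rel n).
Proof. by move=> i; rewrite /path_rel orbb -[X in _ == X]addn0 -addn1 eqn_add2l. Qed.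

Definition path_graph (n : nat) : sgraph :=
  SGraph (@path_rel_sym n) (@path_rel_irr n).

(* Main.v *)
(* After the first move the undominated vertices of the path form maximal runs,
   separated by at least two dominated vertices, and the nimber of the position
   is the nim-sum of the run lengths mod 4.  Indeed a move dominates vertices of
   a single run: dominating one or three changes the parity of the nim-sum, and
   dominating two happens at an end of the run and changes the other bit.
   Conversely, every run has at one of its ends two dominated vertices, from
   which it can be shortened by one, two or three, and Bouton's strategy for Nim
   never needs more.  The nimber of P_n is then the mex of the nim-sums of
   (i - 1) mod 4 and (n - i - 2) mod 4 over the first moves i < n. *)
Require Import Defs.
From HB Require Import structures.
From mathcomp Require Import all_boot.
From mathcomp Require Import zify.
From Stdlib Require Import PeanoNat.

Set Implicit Arguments.
Unset Strict Implicit.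
Unset Printing Implicit Defensive.

Lemma mex_eq (s : seq nat) m :
  (forall k, k < m -> k \in s) -> m \notin s -> mex s = m.
Proof.
move=> lt_m m_s; rewrite /mex; case: ex_minnP => k k_s min_k.
by apply/eqP; rewrite eqn_leq min_k //= leqNgt; apply: contra k_s => /lt_m.
Qed.

Lemma mex_notin (s : seq nat) : mex s \notin s.
Proof. by rewrite /mex; case: ex_minnP. Qed.

Lemma lt_mex_mem (s : seq nat) k : k < mex s -> k \in s.
Proof.
rewrite /mex; case: ex_minnP => m _ min_m; apply: contraTT => /min_m.
by rewrite -leqNgt.
Qed.

Section Outcome.
Variable G : sgraph.
Implicit Types (S : {set G}) (v : G) (p q : player).

Lemma play_ind (P : {set G} -> Prop) :
  (forall S, (forall v, playable S v -> P (v |: S)) -> P S) -> forall S, P S.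
Proof.
move=> IH S; have [m] := ubnP #|~: S|; elim: m S => // m IHm S lt_m.
apply: IH => v /playable_notin vS; apply: IHm; move: lt_m.
by rewrite (cardsD1 v (~: S)) inE vS setCU setIC -setDE.
Qed.

Definition option_nimbers S : seq nat :=
  [seq nimber (v |: S) | v <- enum G & playable S v].

Lemma mem_option_nimbers S k :
  reflect (exists2 v, playable S v & nimber (v |: S) = k)
          (k \in option_nimbers S).
Proof.
apply: (iffP mapP) => [[v] | [v playable_v <-]].
  by rewrite mem_filter => /andP[playable_v _] ->; exists v.
by exists v; rewrite // mem_filter playable_v mem_enum.
Qed.

Lemma nimber_eq S m :
    (forall k, k < m -> exists2 v, playable S v & nimber (v |: S) = k) ->
    (forall v, playable S v -> nimber (v |: S) <> m) ->
  nimber S = m.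
Proof.
move=> reach avoid; rewrite nimberE; apply: mex_eq => [k /reach | ].
  by move/mem_option_nimbers.
by apply/mem_option_nimbers => -[v /avoid].
Qed.

Lemma nimber_play S v : playable S v -> nimber (v |: S) <> nimber S.
Proof.
move=> playable_v eq_nim; have := mex_notin (option_nimbers S).
by rewrite -nimberE -eq_nim => /mem_option_nimbers[]; exists v.
Qed.

Lemma nimber_gt0 S :
  0 < nimber S -> exists2 v, playable S v & nimber (v |: S) = 0.
Proof. by rewrite {1}nimberE => /lt_mex_mem/mem_option_nimbers. Qed.

Lemma winning_nimber p q S :
  winning p q S <-> q = if nimber S == 0 then opponent p else p.
Proof.
have opponent_neq : opponent p <> p by case: p.
split=> [|->].
  elim=> {q S} [S no_move | S v playable_v _ | S _ _ IH].
  - by rewrite (@nimber_eq S 0) // => v; rewrite (negPf (no_move v)).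
  - have := nimber_play playable_v; case: eqP => [-> | _ _ /opponent_neq //].
    by rewrite eq_sym => /eqP/negPf ->.
  - by rewrite (@nimber_eq S 0) // => v /IH; case: eqP => // _ /esym.
elim/play_ind: S => S IH; case: eqP => [S0 | /eqP]; last first.
  rewrite -lt0n => /nimber_gt0[v playable_v v0].
  by apply: (winning_move playable_v); have := IH v playable_v; rewrite v0.
have [/existsP ex_move | /existsPn no_move] := boolP [exists v, playable S v].
  apply: winning_reply => // v playable_v; have := IH v playable_v.
  by have /eqP := nimber_play playable_v; rewrite S0 => /negPf ->.
exact: winning_end.
Qed.

Lemma wins_game_Bob : wins_game G Bob <-> graph_nimber G = 0.
Proof.
rewrite /graph_nimber; split=> [/winning_nimber | nim0]; first by case: eqP.
by apply/winning_nimber; rewrite nim0.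
Qed.

End Outcome.

(** * Nim-sums *)

Local Notation "x (^) y" := (Nat.lxor x y) (at level 50, left associativity).

Lemma lxorA : associative Nat.lxor.
Proof. by move=> x y z; rewrite Nat.lxor_assoc. Qed.

HB.instance Definition _ :=
  Monoid.isComLaw.Build nat 0 Nat.lxor lxorA Nat.lxor_comm Nat.lxor_0_l.

Lemma half_lxor x y : (x (^) y)./2 = x./2 (^) y./2.
Proof.
have halfE z : z./2 = Nat.shiftr z 1 by elim/ltn_ind: z => -[|[|z]] //= -> //.
by rewrite !halfE Nat.shiftr_lxor.
Qed.

Lemma odd_lxor x y : odd (x (^) y) = odd x (+) odd y.
Proof.
have oddE z : odd z = Nat.testbit z 0.
  by elim/ltn_ind: z => -[|[|z]] //= ->; rewrite ?negbK.
by rewrite !oddE Nat.lxor_spec; case: Nat.testbit; case: Nat.testbit.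
Qed.

Lemma lxorK x : involutive (Nat.lxor x).
Proof. by move=> y; rewrite lxorA Nat.lxor_nilpotent Nat.lxor_0_l. Qed.

Lemma ltn_lxor t x y : t < x (^) y -> y (^) t < x \/ x (^) t < y.
Proof.
elim/ltn_ind: t x y => t IHt x y lt_t.
have [t0 | t_gt0] := posnP t.
  rewrite t0 !Nat.lxor_0_r; apply/orP; rewrite -neq_ltn.
  by apply/eqP => xy; rewrite xy Nat.lxor_nilpotent ltn0 in lt_t.
have [lt_half | ge_half] := ltnP t./2 (x (^) y)./2.
  rewrite half_lxor in lt_half.
  have [||] := IHt t./2 _ _ _ lt_half; rewrite -?half_lxor; lia.
have half_t : t./2 = x./2 (^) y./2 by rewrite -half_lxor; lia.
have [t_even] : ~~ odd t /\ odd (x (^) y) by rewrite -half_lxor in half_t; lia.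
rewrite odd_lxor; case: (boolP (odd x)) => [x_odd y_even | x_even y_odd].
- left; suff [] : (y (^) t)./2 = x./2 /\ ~~ odd (y (^) t) by lia.
  rewrite half_lxor half_t [x./2 (^) _]Nat.lxor_comm lxorK odd_lxor.
  by rewrite (negPf t_even) addbF.
- right; suff [] : (x (^) t)./2 = y./2 /\ ~~ odd (x (^) t) by lia.
  by rewrite half_lxor half_t lxorK odd_lxor (negPf t_even) addbF.
Qed.

Lemma nim_lower (T : Type) (heap : T -> nat) (s : seq T) t :
  t < \big[Nat.lxor/0]_(x <- s) heap x ->
  exists s1 x s2 y, [/\ s = s1 ++ x :: s2, y < heap x &
    \big[Nat.lxor/0]_(x <- s1) heap x (^)
      (y (^) \big[Nat.lxor/0]_(x <- s2) heap x) = t].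
Proof.
elim: s t => [|x s IHs] t; first by rewrite big_nil.
rewrite big_cons => /ltn_lxor[lt_x | /IHs[s1 [y [s2 [z [-> lt_zy sum_z]]]]]].
  exists [::], x, s, (\big[Nat.lxor/0]_(y <- s) heap y (^) t); split=> //=.
  by rewrite big_nil Nat.lxor_0_l Nat.lxor_comm lxorK.
by exists (x :: s1), y, s2, z; rewrite big_cons -lxorA sum_z lxorK.
Qed.

(** * Nim values of binary words *)

(* Every letter false separates two runs, which may be empty. *)
Fixpoint runs (w : seq bool) : seq nat :=
  match w with
  | [::] => [:: 0]
  | true :: w' => incr_nth (runs w') 0
  | false :: w' => 0 :: runs w'
  end.

Definition run_word (s : seq nat) : seq bool :=
  false :: flatten [seq rcons (nseq k true) false | k <- s].

Definition run_nim (s : seq nat) : nat := \big[Nat.lxor/0]_(k <- s) (k %% 4).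

Definition word_nim (w : seq bool) : nat := run_nim (runs w).

Lemma size_runs w : size (runs w) = (count negb w).+1.
Proof. by elim: w => [|[] w IHw] //=; rewrite ?size_incr_nth IHw. Qed.

Lemma runs_nseq k : runs (nseq k true) = [:: k].
Proof. by elim: k => //= k ->. Qed.

Lemma runs_cat u w : runs (u ++ false :: w) = runs u ++ runs w.
Proof.
elim: u => [|[] u /= ->] //; have := size_runs u.
by case: (runs u).
Qed.

Lemma runs_insert u w :
  runs (u ++ true :: w) = incr_nth (runs (u ++ w)) (count negb u).
Proof. by elim: u => [|[] u /= ->] //=; rewrite incr_nthC. Qed.

Lemma run_word_runs w : run_word (runs w) = false :: rcons w false.
Proof.
elim: w => [|[] w IHw] //=; last by rewrite -IHw.
by have := size_runs w; case: (runs w) IHw => [//|k s] [<-].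
Qed.

Lemma run_word_cat s1 k s2 :
  run_word (s1 ++ k :: s2) = run_word s1 ++ nseq k true ++ run_word s2.
Proof. by rewrite /run_word map_cat flatten_cat /= cat_rcons. Qed.

Lemma run_word_last_false s : exists u, run_word s = rcons u false.
Proof.
case/lastP: s => [|s k]; first by exists [::].
exists (run_word s ++ nseq k true).
by rewrite -cats1 run_word_cat cats1 -rcons_cat.
Qed.

Lemma run_nim_cons k s : run_nim (k :: s) = (k %% 4) (^) run_nim s.
Proof. exact: big_cons. Qed.

Lemma run_nim_cat s1 s2 : run_nim (s1 ++ s2) = run_nim s1 (^) run_nim s2.
Proof. exact: big_cat. Qed.

Lemma odd_run_nim_incr s i :
  i < size s -> odd (run_nim (incr_nth s i)) = ~~ odd (run_nim s).
Proof.
elim: i s => [|i IHi] [|k s] //= lt_is; rewrite !run_nim_cons !odd_lxor.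
  by rewrite !odd_mod //= addNb.
by rewrite IHi // addbN.
Qed.

Lemma run_nim_incr2 s i : i < size s ->
  run_nim (incr_nth (incr_nth s i) i) = 2 (^) run_nim s.
Proof.
elim: i s => [|i IHi] [|k s] //= lt_is; rewrite !run_nim_cons lxorA.
  rewrite -addn2 -modnDml; congr (_ (^) _).
  by case: (k %% 4) (ltn_pmod k (isT : 0 < 4)) => [|[|[|[|]]]].
by rewrite IHi // lxorA [2 (^) _]Nat.lxor_comm.
Qed.

Lemma run_nim_lower s t : t < run_nim s ->
  exists s1 k s2 j, [/\ s = s1 ++ k :: s2, 0 < j <= 3, j <= k &
                       run_nim (s1 ++ k - j :: s2) = t].
Proof.
move=> /nim_lower[s1 [k [s2 [r [-> lt_rk sum_r]]]]].
exists s1, k, s2, (k %% 4 - r); split=> //; [lia | lia | ].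
rewrite run_nim_cat run_nim_cons -sum_r; congr (_ (^) (_ (^) _)); lia.
Qed.

Lemma word_nim_false w : word_nim (false :: w) = word_nim w.
Proof. by rewrite /word_nim run_nim_cons Nat.lxor_0_l. Qed.

Lemma word_nim_cat u w : word_nim (u ++ false :: w) = word_nim u (^) word_nim w.
Proof. by rewrite /word_nim runs_cat run_nim_cat. Qed.

Lemma word_nim_nseq k : word_nim (nseq k true) = k %% 4.
Proof. by rewrite /word_nim runs_nseq /run_nim big_seq1. Qed.

Lemma word_nim_nil : word_nim [::] = 0.
Proof. exact: (word_nim_nseq 0). Qed.

Lemma word_nim_gap u k w :
  word_nim (u ++ nseq k.+1 false ++ w) = word_nim u (^) word_nim w.
Proof.
rewrite word_nim_cat; congr (_ (^) _).
by elim: k => //= k; rewrite word_nim_false.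
Qed.

Lemma word_nim_padded w : word_nim (false :: rcons w false) = word_nim w.
Proof.
by rewrite word_nim_false -cats1 word_nim_cat word_nim_nil Nat.lxor_0_r.
Qed.

Lemma odd_word_nim w : odd (word_nim w) = odd (count id w).
Proof.
elim: w => [|[] w IHw] /=; first by rewrite word_nim_nil.
- by rewrite /word_nim odd_run_nim_incr ?size_runs // -/(word_nim w) IHw.
- by rewrite word_nim_false.
Qed.

Lemma word_nim_insert2 u w :
  word_nim (u ++ [:: true, true & w]) = 2 (^) word_nim (u ++ w).
Proof.
rewrite /word_nim !runs_insert run_nim_incr2 //.
by rewrite size_runs count_cat ltnS leq_addr.
Qed.

Lemma word_nim_run_word s : word_nim (run_word s) = run_nim s.
Proof.
rewrite word_nim_false; elim: s => [|k s IHs] /=.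
  by rewrite word_nim_nil /run_nim big_nil.
by rewrite cat_rcons word_nim_cat word_nim_nseq IHs run_nim_cons.
Qed.

Definition wide_gaps (w : seq bool) : bool :=
  ~~ infix [:: true; false; true] w.

Inductive erasure : seq bool -> seq bool -> Prop :=
  Erasure (u b w : seq bool) of size b = 3 & true \in b :
    erasure (u ++ b ++ w) (u ++ nseq 3 false ++ w).

Lemma erasure_word_nim_neq w w' :
  wide_gaps w -> erasure w w' -> word_nim w' <> word_nim w.
Proof.
move=> + erases; case: erases => u b v size_b b_true gaps eq_nim.
have even_b : ~~ odd (count id b).
  have /(congr1 odd) := eq_nim; rewrite !odd_word_nim !count_cat !oddD.
  by case: (odd (count id u)) (odd (count id b)) (odd (count id v)) => [] [] [].
have lxor2_neq x : x <> 2 (^) x.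
  move/(congr1 (Nat.lxor x)).
  by rewrite Nat.lxor_nilpotent [2 (^) x]Nat.lxor_comm lxorK.
rewrite (word_nim_gap u 2) in eq_nim.
case: b size_b b_true even_b eq_nim gaps => [|[] [|[] [|[] []]]] //= _ _ _.
- by rewrite word_nim_insert2 word_nim_cat => /lxor2_neq.
- by rewrite /wide_gaps (infix_infix u [:: true; false; true]).
- by rewrite -cat_rcons word_nim_insert2 cat_rcons word_nim_cat => /lxor2_neq.
Qed.

Lemma erasure_after_gap u j w : 0 < j <= 3 ->
  erasure (u ++ nseq 2 false ++ nseq j true ++ w) (u ++ nseq j.+2 false ++ w).
Proof.
case: j => [|[|[|[|]]]] //= _.
- exact: (@Erasure u [:: false; false; true] w).
- have := @Erasure (rcons u false) [:: false; true; true] w.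
  by rewrite !cat_rcons; apply.
- have := @Erasure (rcons (rcons u false) false) [:: true; true; true] w.
  by rewrite !cat_rcons; apply.
Qed.

Lemma erasure_before_gap u j w : 0 < j <= 3 ->
  erasure (u ++ nseq j true ++ nseq 2 false ++ w) (u ++ nseq j.+2 false ++ w).
Proof.
case: j => [|[|[|[|]]]] //= _.
- exact: (@Erasure u [:: true; false; false] w).
- exact: (@Erasure u [:: true; true; false] (false :: w)).
- exact: (@Erasure u [:: true; true; true] [:: false, false & w]).
Qed.

Lemma adjacent_runs_narrow_gap s1 k l s2 :
  wide_gaps (run_word (s1 ++ [:: k.+1, l.+1 & s2])) = false.
Proof.
apply/negbTE; rewrite negbK.
rewrite run_word_cat (run_word_cat [::]) -addn1 nseqD -!catA catA /=.
exact: (infix_infix _ [:: true; false; true]).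
Qed.

Lemma erasure_run_after_gap s1 k s2 j : 0 < j <= 3 -> j <= k ->
  exists2 w, erasure (run_word (s1 ++ [:: 0, k & s2])) w
           & word_nim w = run_nim (s1 ++ [:: 0, k - j & s2]).
Proof.
move=> j_bounds le_jk; have [u s1E] := run_word_last_false s1.
have run_wordE l : run_word (s1 ++ [:: 0, l & s2]) =
    u ++ nseq 2 false ++ nseq l true ++ run_word s2.
  by rewrite run_word_cat (run_word_cat [::]) s1E cat_rcons.
exists (u ++ nseq j.+2 false ++ nseq (k - j) true ++ run_word s2).
  rewrite run_wordE -{1}(subnKC le_jk) nseqD -catA.
  exact: erasure_after_gap.
by rewrite -word_nim_run_word run_wordE !word_nim_gap.
Qed.

Lemma erasure_run_before_gap s1 k s2 j : 0 < j <= 3 -> j <= k ->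
  exists2 w, erasure (run_word (s1 ++ [:: k, 0 & s2])) w
           & word_nim w = run_nim (s1 ++ [:: k - j, 0 & s2]).
Proof.
move=> j_bounds le_jk.
pose u := run_word s1 ++ nseq (k - j) true; pose v := behead (run_word s2).
have run_wordE l : run_word (s1 ++ [:: l, 0 & s2]) =
    run_word s1 ++ nseq l true ++ nseq 2 false ++ v.
  by rewrite run_word_cat.
exists (u ++ nseq j.+2 false ++ v).
  rewrite run_wordE -{1}(subnK le_jk) nseqD -catA catA -/u.
  exact: erasure_before_gap.
by rewrite word_nim_gap -word_nim_run_word run_wordE catA -/u word_nim_gap.
Qed.

Lemma erasure_word_nim_lower w t :
    wide_gaps (false :: rcons w false) ->
    false \in w -> t < word_nim w ->
  exists2 w', erasure (false :: rcons w false) w' & word_nim w' = t.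
Proof.
rewrite -run_word_runs => gaps w_false.
have : 1 < size (runs w).
  by rewrite size_runs ltnS -has_count; apply/hasP; exists false.
move=> size_s /run_nim_lower[s1 [k [s2 [j [sE j_bounds le_jk <-]]]]].
have [k' kE] : exists k', k = k'.+1 by exists k.-1; lia.
rewrite sE in gaps size_s *.
case/lastP: s1 gaps size_s {sE} => [|s1 [|l]].
- case: s2 => [|[|l] s2] // gaps _; first exact: (erasure_run_before_gap [::]).
  by rewrite kE (adjacent_runs_narrow_gap [::]) in gaps.
- by rewrite !cat_rcons => _ _; apply: erasure_run_after_gap.
- by rewrite cat_rcons kE adjacent_runs_narrow_gap.
Qed.

(** * Positions on the path *)

Section Path.
Variable n : nat.
Implicit Types (S : {set path_graph n}) (v : path_graph n).

(* Letter j tells whether the vertex j - 1 is undominated; the letters 0 and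
   n + 1 are padding, so that playing v always erases the letters v, v + 1 and
   v + 2. *)
Definition letter S (j : nat) : bool :=
  (0 < j <= n) && [forall u in S, ~~ (u <= j <= u.+2)].

Definition word S : seq bool := mkseq (letter S) n.+2.

Lemma word_padded S :
  word S = false :: rcons [seq letter S j | j <- iota 1 n] false.
Proof. by rewrite /word mkseqS /= {3}/letter ltnn. Qed.

Lemma dominates_path v (w : path_graph n) : dominates v w = (v <= w.+1 <= v.+2).
Proof. by rewrite /dominates /edge /= /path_rel -val_eqE /=; lia. Qed.

Lemma letter_vertex S (w : path_graph n) : letter S w.+1 = ~~ dominated S w.
Proof.
rewrite /letter ltn_ord /dominated negb_exists_in; apply: eq_forallb_in => u _.
by rewrite dominates_path.
Qed.

Lemma letter_play S v j : letter (v |: S) j = letter S j && ~~ (v <= j <= v.+2).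
Proof.
rewrite /letter -[RHS]andbA; congr (_ && _).
apply/forall_inP/andP => [undom | [undom vj] u].
  split; last by apply: undom; rewrite setU11.
  by apply/forall_inP => u uS; apply: undom; rewrite setU1r.
by rewrite in_setU1 => /predU1P[-> // | uS]; apply: (forall_inP undom).
Qed.

Lemma size_word S : size (word S) = n.+2.
Proof. exact: size_mkseq. Qed.

Lemma iota_around v :
  iota 0 n.+2 = iota 0 v ++ iota v 3 ++ iota v.+3 (n - v.+1).
Proof.
have {1}-> : n.+2 = v + (3 + (n - v.+1)) by have := ltn_ord v; lia.
by rewrite !iotaD add0n addn3.
Qed.

Lemma playable_window S v : playable S v = (true \in take 3 (drop v (word S))).
Proof.
rewrite /word /mkseq (iota_around v) !map_cat.
rewrite drop_size_cat ?take_size_cat ?size_map ?size_iota //.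
apply/existsP/mapP => [[w /andP[]] | [j]].
  rewrite dominates_path -letter_vertex => vw lw.
  by exists w.+1; rewrite ?mem_iota ?addn3.
rewrite mem_iota addn3 => vj /esym lj; have /andP[/andP[j_gt0 le_jn] _] := lj.
have lt_jn : j.-1 < n by rewrite prednK.
exists (Ordinal lt_jn : path_graph n).
by rewrite dominates_path -letter_vertex /= prednK // vj.
Qed.

Lemma word_play S v :
  word (v |: S) = take v (word S) ++ nseq 3 false ++ drop v.+3 (word S).
Proof.
rewrite /word /mkseq (iota_around v) !map_cat.
rewrite take_size_cat ?size_map ?size_iota // [in drop _ _]catA.
rewrite drop_size_cat ?size_cat ?size_map ?size_iota ?addn3 //.
congr (_ ++ (_ ++ _)).
- apply/eq_in_map => j; rewrite mem_iota add0n letter_play [v <= j]leqNgt.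
  by move=> /andP[_ ->]; rewrite andbT.
- rewrite -[nseq 3 false]/(map xpred0 (iota v 3)); apply/eq_in_map => j.
  by rewrite mem_iota addn3 letter_play ltnS => ->; rewrite andbF.
- apply/eq_in_map => j; rewrite mem_iota letter_play => /andP[lt_vj _].
  by rewrite [j <= _]leqNgt lt_vj andbF andbT.
Qed.

Lemma erasure_wordP S w :
  erasure (word S) w <-> exists2 v, playable S v & word (v |: S) = w.
Proof.
split=> [|[v playable_v <-]].
  move wS: (word S) => wS' erases; case: erases wS => u b w' size_b b_true wS.
  have lt_un : size u < n.
    by have := size_word S; rewrite wS !size_cat size_b; lia.
  exists (Ordinal lt_un).
    by rewrite playable_window wS drop_size_cat // take_size_cat.
  rewrite word_play wS take_size_cat // [in drop _ _]catA.
  by rewrite drop_size_cat // size_cat size_b addn3.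
rewrite word_play -{1}(cat_take_drop v (word S)).
rewrite -{1}(cat_take_drop 3 (drop v _)) drop_drop.
apply: Erasure; last by rewrite -playable_window.
by rewrite size_takel // size_drop size_word; have := ltn_ord v; lia.
Qed.

Lemma letter_between S j : letter S j -> letter S j.+2 -> letter S j.+1.
Proof.
move=> /andP[_ /forall_inP undom_j] /andP[/andP[_ lt_jn] /forall_inP undom_j2].
rewrite /letter (ltnW lt_jn) /=; apply/forall_inP => u uS.
by have := undom_j u uS; have := undom_j2 u uS; lia.
Qed.

Lemma wide_gaps_word S : wide_gaps (word S).
Proof.
apply/infixP => -[u [w wS]].
have nthS j :
    j < 3 -> nth false [:: true; false; true] j = letter S (size u + j).
  move=> lt_j3; rewrite -(@nth_mkseq _ false (letter S) n.+2) -/(word S).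
    by rewrite wS nth_cat ltnNge leq_addr addKn nth_cat lt_j3.
  by rewrite -(size_word S) wS !size_cat ltn_add2l ltn_addr.
move: (nthS 0 isT) (nthS 1 isT) (nthS 2 isT).
rewrite /= addn0 addn1 addn2 => letter0 letter1 letter2.
by have := letter_between (esym letter0) (esym letter2); rewrite -letter1.
Qed.

Lemma nimber_word S : S != set0 -> nimber S = word_nim (word S).
Proof.
elim/play_ind: S => S IH S_neq0.
have {}IH v : playable S v -> nimber (v |: S) = word_nim (word (v |: S)).
  by move=> playable_v; apply: IH => //; apply/set0Pn; exists v; apply: setU11.
apply: nimber_eq => [t lt_t | v playable_v]; last first.
  rewrite IH //; apply: erasure_word_nim_neq (wide_gaps_word S) _.
  by apply/erasure_wordP; exists v.
have /set0Pn[v vS] := S_neq0; pose w := [seq letter S j | j <- iota 1 n].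
have v_dominated : false \in w.
  apply/mapP; exists v.+1; first by rewrite mem_iota add1n; apply: ltn_ord.
  apply/esym/negbTE; rewrite letter_vertex negbK; apply/exists_inP.
  by exists v; rewrite /dominates ?eqxx.
have [||w' erases <-] := @erasure_word_nim_lower w t _ v_dominated.
- by rewrite -word_padded wide_gaps_word.
- by rewrite word_padded word_nim_padded in lt_t.
move: erases; rewrite -word_padded => /erasure_wordP[v' playable_v' <-].
by exists v' => //; rewrite IH.
Qed.

Lemma word_set0 : word set0 = false :: rcons (nseq n true) false.
Proof.
rewrite word_padded.
have /all_pred1P -> : all (pred1 true) [seq letter set0 j | j <- iota 1 n].
  apply/allP => _ /mapP[j j_vertex ->]; rewrite mem_iota add1n in j_vertex.
  by rewrite /letter -ltnS j_vertex; apply/eqP/forall_inP => u; rewrite inE.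
by rewrite size_map size_iota.
Qed.

Lemma nimber_first_move v :
  nimber [set v] = (v.-1 %% 4) (^) ((n - v.+2) %% 4).
Proof.
rewrite nimber_word; last by apply/set0Pn; exists v; apply: set11.
rewrite -[[set v]]setU0 word_play (word_nim_gap _ 2) word_set0.
congr (_ (^) _).
  case: v => [[|i] lt_in] /=; first by rewrite word_nim_nil.
  rewrite word_nim_false -cats1 takel_cat ?size_nseq; last lia.
  by rewrite take_nseq ?word_nim_nseq //; lia.
rewrite /= -cats1 drop_cat size_nseq; case: ltnP => [lt_vn | le_nv].
  by rewrite drop_nseq word_nim_cat word_nim_nseq word_nim_nil Nat.lxor_0_r.
rewrite (_ : n - v.+2 = 0); last lia.
by case: (v.+2 - n) => [|[]] *; rewrite /= ?word_nim_false word_nim_nil.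
Qed.

Lemma graph_nimber_path : graph_nimber (path_graph n) =
  mex [seq (i.-1 %% 4) (^) ((n - i.+2) %% 4) | i <- iota 0 n].
Proof.
rewrite /graph_nimber nimberE -val_enum_ord -map_comp.
rewrite (_ : [seq v <- _ | _] = enum 'I_n).
  by congr mex; apply: eq_map => v; rewrite setU0 nimber_first_move.
apply/all_filterP/allP => v _; apply/existsP; exists v.
rewrite /dominates eqxx -letter_vertex /letter ltn_ord /=.
by apply/forall_inP => u; rewrite inE.
Qed.

End Path.

Lemma graph_nimber_path_modn n : 4 <= n ->
  graph_nimber (path_graph n) = nth 0 [:: 0; 1; 1; 3] (n %% 4).
Proof.
move=> n_ge4; rewrite graph_nimber_path.
have lt_r4 : n %% 4 < 4 by rewrite ltn_pmod.
apply: mex_eq => [k lt_k | ].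
  (* The first three vertices already give all the smaller values. *)
  have : k \in [:: (n %% 4 + 2) %% 4; (n %% 4 + 1) %% 4; 1 (^) (n %% 4)].
    case: (n %% 4) lt_r4 k lt_k => [|[|[|[|//]]]] _;
    by case=> [|[|[|]]].
  have -> : (n %% 4 + 2) %% 4 = (n - 2) %% 4 by lia.
  have -> : (n %% 4 + 1) %% 4 = (n - 3) %% 4 by lia.
  have -> : n %% 4 = (n - 4) %% 4 by lia.
  rewrite !inE => /or3P[] /eqP->; apply/mapP.
  - by exists 0; rewrite ?Nat.lxor_0_l ?mem_iota //; lia.
  - by exists 1; rewrite ?Nat.lxor_0_l ?mem_iota //; lia.
  - by exists 2; rewrite ?mem_iota //; lia.
apply/mapP => -[i]; rewrite mem_iota => /= lt_in.
have lt_a4 : i.-1 %% 4 < 4 by rewrite ltn_pmod.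
have lt_b4 : (n - i.+2) %% 4 < 4 by rewrite ltn_pmod.
(* A first move leaves n - 2 vertices in one run at an end, n - 3 otherwise. *)
have : [|| (i.-1 %% 4 == 0) && ((n - i.+2) %% 4 == (n %% 4 + 2) %% 4),
           ((n - i.+2) %% 4 == 0) && (i.-1 %% 4 == (n %% 4 + 2) %% 4) |
           (i.-1 %% 4 + (n - i.+2) %% 4) %% 4 == (n %% 4 + 1) %% 4] by lia.
move: (i.-1 %% 4) ((n - i.+2) %% 4) (n %% 4) lt_a4 lt_b4 lt_r4.
by move=> [|[|[|[|//]]]] [|[|[|[|//]]]] [|[|[|[|//]]]].
Qed.

Lemma graph_nimber_path_small :
  [/\ graph_nimber (path_graph 0) = 0, graph_nimber (path_graph 1) = 1,
      graph_nimber (path_graph 2) = 1 & graph_nimber (path_graph 3) = 2].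
Proof. by rewrite !graph_nimber_path; split; apply: mex_eq => // -[|[]]. Qed.

Theorem theorem3 :
  [/\ graph_nimber (path_graph 1) = 1,
      graph_nimber (path_graph 2) = 1 &
      graph_nimber (path_graph 3) = 2] /\
  (forall n : nat, 4 <= n ->
    [/\ n %% 4 = 0 -> graph_nimber (path_graph n) = 0,
        n %% 4 = 1 -> graph_nimber (path_graph n) = 1,
        n %% 4 = 2 -> graph_nimber (path_graph n) = 1 &
        n %% 4 = 3 -> graph_nimber (path_graph n) = 3]) /\
  (forall n : nat, wins_game (path_graph n) Bob <-> 4 %| n).
Proof.
have [P0 P1 P2 P3] := graph_nimber_path_small.
split=> //; split=> [n n_ge4 | n].
  by split=> n_mod4; rewrite graph_nimber_path_modn // n_mod4.
rewrite wins_game_Bob; have [n_ge4 | ] := leqP 4 n; last first.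
  by case: n => [|[|[|[|//]]]] _; rewrite ?P0 ?P1 ?P2 ?P3.
rewrite graph_nimber_path_modn // /dvdn.
by case: (n %% 4) (ltn_pmod n (isT : 0 < 4)) => [|[|[|[|//]]]].
Qed.
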